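(* Let $(P^{(n)})_{n\in\mathbb Z_+}$ and $(\tilde P^{(n)})_{n\in\mathbb Z_+}$ be two families of Markov semigroups on state spaces $(V^{(n)})_{n\in\mathbb Z_+}$ and $(\tilde V^{(n)})_{n\in\mathbb Z_+}$, with invariant probability measures $(\nu^{(n)})_{n\in\mathbb Z_+}$ and $(\tilde\nu^{(n)})_{n\in\mathbb Z_+}$ respectively. Let $(t^{(n)})_{n\in\mathbb Z_+}$ be a sequence of positive real numbers and (for the window and profile statements) let $(w^{(n)})_{n\in\mathbb Z_+}$ be a sequence of positive real numbers. Assume that for every $n$ there is a symmetric interweaving relation between $P^{(n)}$ and $\tilde P^{(n)}$ with deterministic warm-up time $\boldsymbol t_0^{(n)}\ge0$ and kernels $\Lambda^{(n)},\tilde\Lambda^{(n)}$ satisfying $\tilde\nu^{(n)}=\nu^{(n)}\Lambda^{(n)}$ and $\nu^{(n)}=\tilde\nu^{(n)}\tilde\Lambda^{(n)}$. (a) If $\lim_{n\to\infty}\boldsymbol t_0^{(n)}/t^{(n)}=0$, then $(P^{(n)})_n$ has a cut-off at the cut-off times $(t^{(n)})_n$ if and only if $(\tilde P^{(n)})_n$ has a cut-off at the cut-off times $(t^{(n)})_n$. (b) If $\limsup_{n\to\infty}\boldsymbol t_0^{(n)}/w^{(n)}=0$, then $(P^{(n)})_n$ has a window cut-off at $(t^{(n)},w^{(n)})_n$ (respectively a profile cut-off at $(t^{(n)},w^{(n)})_n$ with profile $\eta$) if and only if $(\tilde P^{(n)})_n$ has a window cut-off at $(t^{(n)},w^{(n)})_n$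 (respectively a profile cut-off at $(t^{(n)},w^{(n)})_n$ with profile $\eta$).
   Context: A Markov semigroup on a measurable space $(V,\mathcal V)$ is a family $P=(P_t)_{t\ge0}$ of Markov (probability) kernels from $V$ to $V$ such that $(t,x)\mapsto P_t(x,A)$ is measurable for every $A\in\mathcal V$ and $P_tP_s=P_{t+s}$ for all $s,t\ge0$. A kernel acts on probability measures by $m\Lambda(A)=\int m(dx)\Lambda(x,A)$. A symmetric interweaving relation between $P$ and $\tilde P$ with deterministic warm-up time $t_0$ and Markov kernels $\Lambda$ (from $V$ to $\tilde V$), $\tilde\Lambda$ (from $\tilde V$ to $V$) means that for all $t\ge0$ $$P_t\Lambda=\Lambda\tilde P_t,\qquad\tilde P_t\tilde\Lambda=\tilde\Lambda P_t,\qquad\Lambda\tilde\Lambda=P_{t_0},\qquad\tilde\Lambda\Lambda=\tilde P_{t_0}.$$ The total variation distance is $\|m-\nu\|_{\mathrm{tv}}=\sup_{A}(m(A)-\nu(A))$. For a family $(P^{(n)})_n$ with invariant probabilities $\nu^{(n)}$ on $V^{(n)}$, put $$\mathfrak d^{(n)}(t)=\sup_{m_0}\|m_0P^{(n)}_t-\nu^{(n)}\|_{\mathrm{tv}},\qquad t\ge0,$$ the supremum being over all probability measures $m_0$ on $V^{(n)}$. The family has a (uniform) cut-off at the cut-off times $(t^{(n)})$ if for every $r\in(0,1)\cup(1,\infty)$, $\lim_{n\to\infty}\mathfrak d^{(n)}(rt^{(n)})=1$ if $0<r<1$ and $=0$ if $r>1$. The family has a window cut-off at $(t^{(n)},w^{(n)})$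 if $t^{(n)}\to\infty$, $w^{(n)}=o(t^{(n)})$ as $n\to\infty$, and $$\lim_{c\to-\infty}\liminf_{n\to\infty}\mathfrak d^{(n)}(t^{(n)}+cw^{(n)})=1,\qquad\lim_{c\to+\infty}\limsup_{n\to\infty}\mathfrak d^{(n)}(t^{(n)}+cw^{(n)})=0.$$ It has a profile cut-off at $(t^{(n)},w^{(n)})$ with profile $\eta$ if moreover for all $c\in\mathbb R$, $\eta(c)=\liminf_{n\to\infty}\mathfrak d^{(n)}(t^{(n)}+cw^{(n)})=\limsup_{n\to\infty}\mathfrak d^{(n)}(t^{(n)}+cw^{(n)})$.
   Formalization: In the profile statement of (b) the profile η is assumed to be continuous; for a discontinuous η the equivalence fails in general, since a shift of the times by the warm-up time can change the limit at a jump of η. *)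

(* Defs.v *)
From HB Require Import structures.
From mathcomp Require Import all_boot all_order all_algebra.
From mathcomp Require Import all_classical all_reals all_analysis.
From mathcomp Require Import measurable_realfun.

Set Implicit Arguments.
Unset Strict Implicit.
Unset Printing Implicit Defensive.

Import Order.TTheory GRing.Theory Num.Theory.
Import numFieldNormedType.Exports.

Local Open Scope classical_set_scope.
Local Open Scope ring_scope.
Local Open Scope ereal_scope.

Section Kernels.
Context {R : realType}.

(* Measures are functions on all sets, whose values on non-measurable sets are
   irrelevant; kernels are therefore compared on measurable sets only. *)
Definition keq d d' (X : measurableType d) (Y : measurableType d')
    (k1 k2 : X -> {measure set Y -> \bar R}) : Prop :=
  forall x A, measurable A -> k1 x A = k2 x A.

(* m k (A) = \int m(dx) k(x, A) *)
Definition kact d d' (X : measurableType d) (Y : measurableType d')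
    (m : {measure set X -> \bar R}) (k : X -> {measure set Y -> \bar R})
    (A : set Y) : \bar R :=
  \int[m]_x k x A.

Definition tv_dist d (X : measurableType d) (m nu : set X -> \bar R) : \bar R :=
  ereal_sup [set m A - nu A | A in measurable].

End Kernels.

Section MarkovSemigroups.
Context {R : realType} d (V : measurableType d).

(* Only the kernels P t with t >= 0 are meaningful; the values of P at negative
   times are unconstrained. *)
Definition markov_semigroup (P : R -> R.-pker V ~> V) : Prop :=
  (forall A : set V, measurable A ->
     measurable_fun ([set t : R | (0 <= t)%R] `*` [set: V])
       (fun tx : R * V => P tx.1 tx.2 A)) /\
  (forall s t : R, (0 <= s)%R -> (0 <= t)%R ->
     keq (mkcomp_noparam (P t) (P s)) (P (t + s)%R)).

Definition invariant_probability (P : R -> R.-pker V ~> V)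
    (nu : probability V R) : Prop :=
  forall t : R, (0 <= t)%R ->
    forall A : set V, measurable A -> kact nu (P t) A = nu A.

Definition worst_tv (P : R -> R.-pker V ~> V) (nu : probability V R) (t : R) :
    \bar R :=
  ereal_sup [set tv_dist (kact m0 (P t)) nu | m0 in [set: probability V R]].

End MarkovSemigroups.

Definition symmetric_interweaving (R : realType) d d'
    (V : measurableType d) (V' : measurableType d')
    (P : R -> R.-pker V ~> V) (P' : R -> R.-pker V' ~> V')
    (t0 : R) (L : R.-pker V ~> V') (L' : R.-pker V' ~> V) : Prop :=
  [/\ forall t : R, (0 <= t)%R ->
        keq (mkcomp_noparam (P t) L) (mkcomp_noparam L (P' t)),
      forall t : R, (0 <= t)%R ->
        keq (mkcomp_noparam (P' t) L') (mkcomp_noparam L' (P t)),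
      keq (mkcomp_noparam L L') (P t0)
    & keq (mkcomp_noparam L' L) (P' t0)].

Section CutOff.
Context {R : realType} (d : nat -> measure_display).
Variables (V : forall n, measurableType (d n)).
Variables (P : forall n, R -> R.-pker V n ~> V n).
Variables (nu : forall n, probability (V n) R).

Definition cut_off (t : nat -> R) : Prop :=
  forall r : R,
    ((0 < r < 1)%R ->
       worst_tv (P n) (nu n) (r * t n)%R @[n --> \oo] --> 1) /\
    ((1 < r)%R ->
       worst_tv (P n) (nu n) (r * t n)%R @[n --> \oo] --> 0).

(* For fixed c the time t n + c * w n may be negative, but under the first two
   requirements of window_cut_off only for finitely many n, so that the values
   of P at negative times have no influence. *)
Definition liminf_at (t w : nat -> R) (c : R) : \bar R :=
  limn_einf (fun n => worst_tv (P n) (nu n) (t n + c * w n)%R).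

Definition limsup_at (t w : nat -> R) (c : R) : \bar R :=
  limn_esup (fun n => worst_tv (P n) (nu n) (t n + c * w n)%R).

Definition window_cut_off (t w : nat -> R) : Prop :=
  [/\ t n @[n --> \oo] --> +oo%R,
      (w : nat -> R^o) =o_\oo (t : nat -> R^o),
      liminf_at t w c @[c --> -oo%R] --> 1
    & limsup_at t w c @[c --> +oo%R] --> 0].

(* No regularity is imposed on eta. When eta jumps at c, moving the times t n by
   o(w n) can change the limit at c, so that the profile itself is stable under
   such shifts only if eta is continuous. *)
Definition profile_cut_off (t w : nat -> R) (eta : R -> R) : Prop :=
  window_cut_off t w /\
  forall c : R, (eta c)%:E = liminf_at t w c /\ (eta c)%:E = limsup_at t w c.

End CutOff.

(* Main.v *)
(* For s >= 0, m P'_(t0 + s) = m L' L P'_s = (m L' P_s) L and nu' = nu L; as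
   kernels do not increase the total variation distance, the worst-case
   distances satisfy d'(t0 + s) <= d(s), and symmetrically d(t0 + s) <= d'(s).
   Both are nonincreasing in time, so each is squeezed between translates of
   the other by t0, and t0 is negligible with respect to t (cut-off) or w
   (window and profile). For the profile, the translation by e w, with e > 0
   arbitrary, disappears in the limit because eta is continuous. *)
Require Import Defs.
From HB Require Import structures.
From mathcomp Require Import all_boot all_order all_algebra.
From mathcomp Require Import all_classical all_reals all_analysis.
From mathcomp Require Import measurable_realfun.
From mathcomp Require Import lra.

Set Implicit Arguments.
Unset Strict Implicit.
Unset Printing Implicit Defensive.

Import Order.TTheory GRing.Theory Num.Theory.
Import numFieldNormedType.Exports.

Local Open Scope classical_set_scope.
Local Open Scope ring_scope.

(** * Action of kernels on probability measures *)

Section KernelAction.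
Local Open Scope ereal_scope.
Context {R : realType} d d' (X : measurableType d) (Y : measurableType d').

(* [m] is made a kernel from [unit] so that [mkcomp] and [integral_kcomp]
   apply. *)
Definition pact (m : probability X R) (k : R.-pker X ~> Y) :
    set Y -> \bar R :=
  mkcomp (kprobability (measurable_cst (m : pprobability X R)))
         (kernel.kernel_snd (T0 := unit) k) tt.

Variables (m : probability X R) (k : R.-pker X ~> Y).

HB.instance Definition _ := Measure.on (pact m k).

Let pact_setT : pact m k setT = 1.
Proof.
rewrite /pact/= /kcomp/= /kernel.kernel_snd/=.
under eq_integral do rewrite prob_kernel.
by rewrite integral_cst// mul1e; exact: (probability_setT m).
Qed.

HB.instance Definition _ :=
  Measure_isProbability.Build _ _ _ (pact m k) pact_setT.

Lemma pactE A : pact m k A = kact m k A.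
Proof. by []. Qed.

End KernelAction.

Section KernelActionComp.
Local Open Scope ereal_scope.
Context {R : realType} d d' d'' (X : measurableType d) (Y : measurableType d')
  (Z : measurableType d'').

(** Serves in place of rewriting: the hypotheses on the kernels only give [keq], that is agreement
    on measurable sets, never equality of kernels. *)
Lemma eq_kact (m1 m2 : {measure set X -> \bar R})
    (k1 k2 : X -> {measure set Y -> \bar R}) A :
  (forall B, measurable B -> m1 B = m2 B) -> keq k1 k2 -> measurable A ->
  kact m1 k1 A = kact m2 k2 A.
Proof.
move=> m12 k12 mA; rewrite /kact (eq_measure_integral m2)//.
  by apply: eq_integral => x _; exact: k12.
by move=> B mB _; exact: m12.
Qed.

(** Associativity of the action: since [pact m k1] is itself a composed kernel, an integral against
    it unfolds into an iterated integral. *)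
Lemma kact_comp (m : probability X R) (k1 : R.-pker X ~> Y)
    (k2 : R.-pker Y ~> Z) A : measurable A ->
  kact m (mkcomp_noparam k1 k2) A = kact (pact m k1) k2 A.
Proof.
by move=> mA; rewrite /kact integral_kcomp//; exact: measurable_kernel.
Qed.

End KernelActionComp.

(** * Total variation and its contraction under kernels *)

Section TotalVariation.
Local Open Scope ereal_scope.
Context {R : realType} d (X : measurableType d).

(** Restricting both measures to [S] turns the comparison inside [S] into one on all measurable
    sets. The two halves of a Hahn decomposition provide only such local comparisons. *)
Lemma ge0_le_measure_integral_in (m1 m2 : {measure set X -> \bar R})
    (S : set X) (f : X -> \bar R) :
  measurable S ->
  (forall A, measurable A -> A `<=` S -> m1 A <= m2 A) ->
  (forall x, 0 <= f x) -> measurable_fun setT f ->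
  \int[m1]_(x in S) f x <= \int[m2]_(x in S) f x.
Proof.
move=> mS m12 f0 mf.
have mr (m : {measure set X -> \bar R}) :
    \int[m]_(x in S) f x = \int[mrestr m mS]_(x in S) f x.
  by apply: eq_measure_integral => A mA AS; rewrite /= /mrestr setIidl.
rewrite (mr m1) (mr m2); apply: ge0_le_measure_integral => // A mA.
by apply: m12; [exact: measurableI|exact: subIsetr].
Qed.

Lemma tv_dist_ge (m nu : probability X R) A :
  measurable A -> m A - nu A <= tv_dist m nu.
Proof. by move=> mA; apply: ereal_sup_ubound; exists A. Qed.

Lemma tv_dist_ge0 (m nu : set X -> \bar R) :
  m set0 = 0 -> nu set0 = 0 -> 0 <= tv_dist m nu.
Proof.
move=> m0 nu0; apply: ereal_sup_ubound; exists set0 => //.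
by rewrite m0 nu0 sube0.
Qed.

Lemma tv_dist_le1 (m nu : probability X R) : tv_dist m nu <= 1.
Proof.
apply: ge_ereal_sup => _ [A mA <-].
rewrite leeBlDr ?fin_num_measure//.
by rewrite (le_trans (probability_le1 _ _))// leeDl.
Qed.

(* Take for [S] the positive set of a Hahn decomposition of [m - nu]: compare
   the integrals of [f] off [S] and those of [1 - f] on [S]. *)
Lemma integral_le_tv (m nu : probability X R) (f : X -> \bar R) :
  (forall x, 0 <= f x <= 1) -> measurable_fun setT f ->
  \int[m]_x f x - \int[nu]_x f x <= tv_dist m nu.
Proof.
move=> f01 mf.
have f0 x : 0 <= f x by case/andP: (f01 x).
have g0 x : 0 <= 1 - f x by rewrite sube_ge0 ?orbT//; case/andP: (f01 x).
have fin01 x : f x \is a fin_num.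
  by rewrite ge0_fin_numE// (le_lt_trans _ (ltry 1))//; case/andP: (f01 x).
have mg : measurable_fun setT (fun x => 1 - f x) by exact: emeasurable_funB.
pose cm := charge_of_finite_measure m : {charge set X -> \bar R}.
pose cn := charge_of_finite_measure nu : {charge set X -> \bar R}.
have [S [N [[mS posS] [mN negN] SN SN0]]] :=
  Hahn_decomposition (cadd cm (copp cn)).
have leN : \int[m]_(x in N) f x <= \int[nu]_(x in N) f x.
  apply: ge0_le_measure_integral_in => // A mA AN.
  rewrite -sube_le0; exact: negN.
have leS : \int[nu]_(x in S) (1 - f x) <= \int[m]_(x in S) (1 - f x).
  apply: ge0_le_measure_integral_in => // A mA AS.
  rewrite -sube_ge0 ?fin_num_measure//; exact: posS.
have ifin (p : probability X R) (h : X -> \bar R) B : measurable B ->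
    (forall x, 0 <= h x <= 1) -> measurable_fun setT h ->
    \int[p]_(x in B) h x \is a fin_num.
  move=> mB h01 mh.
  have h0 x : 0 <= h x by case/andP: (h01 x).
  rewrite ge0_fin_numE ?integral_ge0//.
  apply: (@le_lt_trans _ _ (\int[p]_(x in B) 1)).
    apply: ge0_le_integral => //; first exact: measurable_funTS.
    by move=> x _; case/andP: (h01 x).
  by rewrite integral_cst// mul1e -ge0_fin_numE// fin_num_measure.
have split1 (p : probability X R) :
    \int[p]_(x in S) f x + \int[p]_(x in S) (1 - f x) = p S.
  rewrite -ge0_integralD//; [|exact: measurable_funTS..].
  rewrite (eq_integral (cst 1)) ?integral_cst ?mul1e// => x _.
  by rewrite addeC subeK.
have splitT (p : probability X R) :
    \int[p]_x f x = \int[p]_(x in S) f x + \int[p]_(x in N) f x.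
  rewrite -SN ge0_integral_setU//; first by rewrite SN.
  by apply/disj_setPS; rewrite SN0.
have g01 x : 0 <= 1 - f x <= 1 by rewrite g0 leeBlDr ?leeDl//; exact: fin01.
apply: le_trans (tv_dist_ge m nu mS).
(* The integrals of [f] over [S] cancel, leaving [leN] on the left and [leS] on the right;
   finiteness of the six integrals reduces this to real arithmetic. *)
rewrite -!split1 !splitT.
move: leN leS.
have := ifin m _ _ mS f01 mf; have := ifin m _ _ mN f01 mf.
have := ifin nu _ _ mS f01 mf; have := ifin nu _ _ mN f01 mf.
have := ifin m _ _ mS g01 mg; have := ifin nu _ _ mS g01 mg.
move=> /fineK <- /fineK <- /fineK <- /fineK <- /fineK <- /fineK <-.
by rewrite -!EFinD !lee_fin => *; lra.
Qed.

(** For fixed [A], the function sending [x] to [k x A] is measurable with values in [0, 1], so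
    [integral_le_tv] bounds each term of the supremum. *)
Lemma tv_dist_kact d' (Y : measurableType d') (m nu : probability X R)
    (k : R.-pker X ~> Y) :
  tv_dist (kact m k) (kact nu k) <= tv_dist m nu.
Proof.
apply: ge_ereal_sup => _ [A mA <-].
apply: integral_le_tv => [x|]; last exact: measurable_kernel.
by rewrite measure_ge0 -(prob_kernel (s := k) x) le_measure ?inE.
Qed.

End TotalVariation.

(** * Bounds and monotonicity of the worst-case distance *)

Section WorstTotalVariation.
Local Open Scope ereal_scope.
Context {R : realType} d (V : measurableType d).
Variables (P : R -> R.-pker V ~> V) (nu : probability V R).

Lemma worst_tv_ge0 t : 0 <= worst_tv P nu t.
Proof.
(* One nonnegative term suffices for the supremum; [nu] is at hand as a starting law. *)
apply: le_trans (_ : tv_dist (kact nu (P t)) nu <= _).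
  by apply: tv_dist_ge0; rewrite ?measure0// -pactE measure0.
by apply: ereal_sup_ubound; exists nu.
Qed.

Lemma worst_tv_le1 t : worst_tv P nu t <= 1.
Proof.
by apply: ge_ereal_sup => _ [m _ <-]; exact: (tv_dist_le1 (pact m _)).
Qed.

Lemma eq_tv_dist (m1 m2 : set V -> \bar R) :
  (forall A, measurable A -> m1 A = m2 A) -> tv_dist m1 nu = tv_dist m2 nu.
Proof.
move=> m12; congr ereal_sup; apply/seteqP.
by split=> _ [A mA <-]; exists A; rewrite ?m12.
Qed.

(** Running from [m] up to time [t] amounts to running up to time [s] from the law of the process at
    time [t - s], which competes in the supremum at [s]. *)
Lemma worst_tv_anti s t : markov_semigroup P ->
  (0 <= s)%R -> (s <= t)%R -> worst_tv P nu t <= worst_tv P nu s.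
Proof.
move=> [_ PD] s0 st; apply: ge_ereal_sup => _ [m _ <-].
apply: ereal_sup_ubound; exists (pact m (P (t - s)%R)) => //.
apply: eq_tv_dist => A mA; rewrite -kact_comp//.
by apply: eq_kact => // x B mB; rewrite PD ?subr_ge0// subrK.
Qed.

End WorstTotalVariation.

(** * Comparison of worst-case distances through interweaving *)

Section Interweaving.
Local Open Scope ereal_scope.
Context {R : realType} d d' (V : measurableType d) (V' : measurableType d').
Variables (P : R -> R.-pker V ~> V) (P' : R -> R.-pker V' ~> V').
Variables (L : R.-pker V ~> V') (L' : R.-pker V' ~> V) (t0 : R).

Lemma symmetric_interweaving_sym :
  symmetric_interweaving P P' t0 L L' -> symmetric_interweaving P' P t0 L' L.
Proof. by case. Qed.

Lemma worst_tv_interweaving (nu : probability V R) (nu' : probability V' R) s :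
  markov_semigroup P' -> symmetric_interweaving P P' t0 L L' ->
  (forall A, measurable A -> nu' A = kact nu L A) ->
  (0 <= t0)%R -> (0 <= s)%R ->
  worst_tv P' nu' (t0 + s) <= worst_tv P nu s.
Proof.
move=> [_ PD'] [PL _ _ L'L] nuL t00 s0; apply: ge_ereal_sup => _ [m _ <-].
have mE A : measurable A ->
    kact m (P' (t0 + s)%R) A = kact (pact (pact m L') (P s)) L A.
  (* On the right, [PL] moves [L] before [P' s]; on the left, the semigroup law splits off [P' s].
     The laws to which [P' s] is applied then agree by [L'L]. *)
  move=> mA; rewrite -kact_comp//.
  rewrite (@eq_kact _ _ _ _ _ _ (pact m L') _ (mkcomp_noparam L (P' s)))//;
    last exact: PL.
  rewrite kact_comp//.
  rewrite (@eq_kact _ _ _ _ _ _ m _ (mkcomp_noparam (P' t0) (P' s)))//;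
    last by move=> x B mB; rewrite PD'.
  rewrite kact_comp//; apply: eq_kact => // B mB.
  transitivity (kact m (mkcomp_noparam L' L) B); last exact: kact_comp.
  by apply: eq_kact => // x C mC; rewrite L'L.
apply: (@le_trans _ _ (tv_dist (pact (pact m L') (P s)) nu)).
  apply: le_trans (tv_dist_kact _ _ L).
  apply: ge_ereal_sup => _ [A mA <-].
  by rewrite mE// nuL//; apply: ereal_sup_ubound; exists A.
by apply: ereal_sup_ubound; exists (pact m L').
Qed.

Lemma worst_tv_le_interweaving (nu : probability V R) (nu' : probability V' R)
    a b :
  markov_semigroup P -> markov_semigroup P' ->
  symmetric_interweaving P P' t0 L L' ->
  (forall A, measurable A -> nu' A = kact nu L A) ->
  (0 <= t0)%R -> (0 <= a)%R -> (a + t0 <= b)%R ->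
  worst_tv P' nu' b <= worst_tv P nu a.
Proof.
move=> hP hP' hint nuL t00 a0 ab; rewrite -(subrKC t0 b).
have ab' : (a <= b - t0)%R by rewrite lerBrDr.
apply: le_trans (worst_tv_anti _ hP a0 ab').
by apply: worst_tv_interweaving => //; exact: le_trans ab'.
Qed.

End Interweaving.

(** * Upper and lower limits *)

Section LimSup.
Local Open Scope ereal_scope.
Context {R : realType}.
Implicit Types u v : (\bar R)^nat.

(** The upper limit is an infimum of suprema over the sets of the filter, and each such set may be
    cut down to the indices where [u n <= v n]. *)
Lemma le_limn_esup u v :
  (\forall n \near \oo, u n <= v n) -> limn_esup u <= limn_esup v.
Proof.
move=> uv; apply: le_ereal_inf_tmp => _ [A ooA <-].
apply: (@le_trans _ _ (ereal_sup (u @` (A `&` [set n | u n <= v n])))).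
  apply: ereal_inf_lbound; exists (A `&` [set n | u n <= v n]) => //.
  exact: filterI.
apply: ge_ereal_sup => _ [n [An uvn] <-].
by apply: (le_trans uvn); apply: ereal_sup_ubound; exists n.
Qed.

Lemma le_limn_einf u v :
  (\forall n \near \oo, u n <= v n) -> limn_einf u <= limn_einf v.
Proof.
move=> uv; rewrite /limn_einf leeN2; apply: le_limn_esup.
by apply: filterS uv => n; rewrite leeN2.
Qed.

Lemma limn_esup_cst (x : \bar R) : limn_esup (fun=> x) = x.
Proof. by have [_ ->] := cvg_limn_einf_sup (@cvg_cst _ x _ \oo _). Qed.

Lemma limn_einf_cst (x : \bar R) : limn_einf (fun=> x) = x.
Proof. by have [-> _] := cvg_limn_einf_sup (@cvg_cst _ x _ \oo _). Qed.

Local Close Scope ereal_scope.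

Lemma limn_esup0_cvg (u : nat -> R) : (forall n, 0 <= u n) ->
  limn_esup (fun n => (u n)%:E) = 0%E -> u n @[n --> \oo] --> 0.
Proof.
move=> u0 supu; apply: (@fine_cvg _ _ \oo _ (EFin \o u)).
by apply: limn_esup_le_cvg => [|n]; [rewrite supu|rewrite lee_fin].
Qed.

Lemma near_le_scale (u v : nat -> R) (e : R) : (forall n, 0 < v n) ->
  u n / v n @[n --> \oo] --> 0 -> 0 < e -> \forall n \near \oo, u n <= e * v n.
Proof.
move=> v0 uv e0; near=> n; rewrite -ler_pdivrMr//; apply: ltW.
by near: n; exact: (cvgr_lt 0).
Unshelve. all: by end_near. Qed.

End LimSup.

(** * Transfer of cut-offs from one family to the other *)

Section Transfer.
Context {R : realType} {d d' : nat -> measure_display}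
  {V : forall n, measurableType (d n)} {V' : forall n, measurableType (d' n)}.
Context {P : forall n, R -> R.-pker V n ~> V n}
  {P' : forall n, R -> R.-pker V' n ~> V' n}
  {nu : forall n, probability (V n) R} {nu' : forall n, probability (V' n) R}.
Context {t t0 : nat -> R}.
Hypothesis le_tv : forall n a b, 0 <= a -> a + t0 n <= b ->
  (worst_tv (P' n) (nu' n) b <= worst_tv (P n) (nu n) a)%E.
Hypothesis le_tv' : forall n a b, 0 <= a -> a + t0 n <= b ->
  (worst_tv (P n) (nu n) b <= worst_tv (P' n) (nu' n) a)%E.
Hypothesis t_gt0 : forall n, 0 < t n.

Lemma cut_off_transfer : t0 n / t n @[n --> \oo] --> 0 ->
  cut_off P nu t -> cut_off P' nu' t.
Proof.
move=> t0t cut r; split => hr.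
(* The midpoint of [r] and 1 stays on the same side of 1, and its gap to [r], scaled by [t n],
   eventually absorbs [t0 n]. *)
- have hr' : 0 < (r + 1) / 2 < 1 by lra.
  apply: (@squeeze_cvge _ _ _ _ _ _ (cst 1%E)); last exact: cvg_cst;
    last exact: (cut _).1 hr'.
  near=> n; rewrite worst_tv_le1 andbT; apply: le_tv'.
    by rewrite mulr_ge0 ?ltW//; lra.
  have : t0 n <= (1 - r) / 2 * t n.
    by near: n; apply: near_le_scale => //; lra.
  lra.
- have hr' : 1 < (r + 1) / 2 by lra.
  apply: (@squeeze_cvge _ _ _ _ (cst 0%E)); [|exact: cvg_cst|
    exact: (cut _).2 hr'].
  near=> n; rewrite worst_tv_ge0/=; apply: le_tv.
    by rewrite mulr_ge0 ?ltW//; lra.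
  have : t0 n <= (r - 1) / 2 * t n.
    by near: n; apply: near_le_scale => //; lra.
  lra.
Unshelve. all: by end_near. Qed.

Context {w : nat -> R}.
Hypothesis w_gt0 : forall n, 0 < w n.

(** Supplies the condition [0 <= a] of [le_tv] and [le_tv'] at window times. *)
Lemma near_window_ge0 (c : R) : (w : nat -> R^o) =o_\oo (t : nat -> R^o) ->
  \forall n \near \oo, 0 <= t n + c * w n.
Proof.
(* With this constant, eventually [(|c| + 1) * w n <= t n], hence [t n + c * w n >= w n]; the added
   1 covers [c = 0]. *)
move=> wt; have e0 : 0 < (`|c| + 1)^-1 by rewrite invr_gt0 ltr_wpDl.
have /eqoP/(_ _ e0) wt_near := wt.
near=> n.
have : `|w n| <= (`|c| + 1)^-1 * `|t n| by near: n.
rewrite (gtr0_norm (w_gt0 n)) (gtr0_norm (t_gt0 n)) mulrC.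
rewrite ler_pdivlMr ?ltr_wpDl// => wtn.
have : - (`|c| * w n) <= c * w n.
  by rewrite -mulNr ler_pM2r// lerNl -normrN ler_norm.
have := w_gt0 n; lra.
Unshelve. all: by end_near. Qed.

Section Shift.
Hypothesis wt : (w : nat -> R^o) =o_\oo (t : nat -> R^o).
Hypothesis t0w : t0 n / w n @[n --> \oo] --> 0.

(** The delay [t0 n] is eventually at most [e * w n], so it costs no more than a shift of [c] by
    [e]. *)
Lemma limsup_at_shift (c e : R) : 0 < e ->
  (limsup_at P' nu' t w c <= limsup_at P nu t w (c - e))%E.
Proof.
move=> e0; apply: le_limn_esup; near=> n; apply: le_tv.
  by near: n; exact: near_window_ge0.
have : t0 n <= e * w n by near: n; exact: near_le_scale.
lra.
Unshelve. all: by end_near. Qed.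

Lemma liminf_at_shift (c e : R) : 0 < e ->
  (liminf_at P nu t w (c + e) <= liminf_at P' nu' t w c)%E.
Proof.
move=> e0; apply: le_limn_einf; near=> n; apply: le_tv'.
  by near: n; exact: near_window_ge0.
have : t0 n <= e * w n by near: n; exact: near_le_scale.
lra.
Unshelve. all: by end_near. Qed.

End Shift.

Lemma window_cut_off_transfer : t0 n / w n @[n --> \oo] --> 0 ->
  window_cut_off P nu t w -> window_cut_off P' nu' t w.
Proof.
move=> t0w [toy wt inf1 sup0]; split => //.
(* Any fixed shift is harmless for limits at infinity in [c]; 1 is chosen here and below. *)
- apply: (@squeeze_cvge _ _ _ _ (fun c => liminf_at P nu t w (c + 1)) _
      (cst 1%E)); last exact: cvg_cst.
    near=> c; rewrite liminf_at_shift//=.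
    rewrite -[leRHS](limn_einf_cst 1%E); apply: le_limn_einf.
    by apply: nearW => n; exact: worst_tv_le1.
  apply: cvg_comp inf1; apply/cvgrNyPle => A; near=> c.
  by rewrite -lerBrDr; near: c; apply: nbhs_ninfty_le; rewrite num_real.
- apply: (@squeeze_cvge _ _ _ _ (cst 0%E) _
      (fun c => limsup_at P nu t w (c - 1))); first last.
  + by rewrite cvg_shiftr.
  + exact: cvg_cst.
  near=> c; rewrite limsup_at_shift// andbT.
  rewrite -[leLHS](limn_esup_cst 0%E); apply: le_limn_esup.
  by apply: nearW => n; exact: worst_tv_ge0.
Unshelve. all: by end_near. Qed.

Lemma profile_cut_off_transfer (eta : R -> R) : continuous eta ->
  t0 n / w n @[n --> \oo] --> 0 ->
  profile_cut_off P nu t w eta -> profile_cut_off P' nu' t w eta.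
Proof.
move=> ceta t0w [win prof]; split; first exact: window_cut_off_transfer.
have [_ wt _ _] := win.
move=> c.
(* For [x < c], the shift by [c - x] bounds the upper limit by [eta x]; letting [x] tend to [c] from
   the left, continuity gives [eta c]. The lower limit is treated from the right. *)
have sup_eta : (limsup_at P' nu' t w c <= (eta c)%:E)%E.
  apply: (@cvge_ge _ (c^'-) _ _ (EFin \o eta)).
    near=> x; rewrite /= (prof x).2 -[x](subKr c).
    by apply: limsup_at_shift => //; rewrite subr_gt0.
  apply/fine_cvgP; split; first exact: nearW.
  by apply: cvg_at_left_filter; exact: ceta.
have inf_eta : ((eta c)%:E <= liminf_at P' nu' t w c)%E.
  apply: (@cvge_le _ (c^'+) _ _ (EFin \o eta)).
    near=> x; rewrite /= (prof x).1 -[x](subrKC c).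
    by apply: liminf_at_shift => //; rewrite subr_gt0.
  apply/fine_cvgP; split; first exact: nearW.
  by apply: cvg_at_right_filter; exact: ceta.
have inf_sup : (liminf_at P' nu' t w c <= limsup_at P' nu' t w c)%E.
  exact: limn_einf_sup.
split; apply/le_anti/andP; split => //.
- exact: le_trans inf_sup sup_eta.
- exact: le_trans inf_eta inf_sup.
Unshelve. all: by end_near. Qed.

End Transfer.

Theorem theorem10 (R : realType)
    (d d' : nat -> measure_display)
    (V : forall n, measurableType (d n))
    (V' : forall n, measurableType (d' n))
    (P : forall n, R -> R.-pker V n ~> V n)
    (P' : forall n, R -> R.-pker V' n ~> V' n)
    (nu : forall n, probability (V n) R)
    (nu' : forall n, probability (V' n) R)
    (t : nat -> R) (t0 : nat -> R)
    (L : forall n, R.-pker V n ~> V' n)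
    (L' : forall n, R.-pker V' n ~> V n)
    (hP : forall n, markov_semigroup (P n))
    (hP' : forall n, markov_semigroup (P' n))
    (hnu : forall n, invariant_probability (P n) (nu n))
    (hnu' : forall n, invariant_probability (P' n) (nu' n))
    (ht : forall n, 0 < t n)
    (ht0 : forall n, 0 <= t0 n)
    (hint : forall n,
       symmetric_interweaving (P n) (P' n) (t0 n) (L n) (L' n))
    (hnuL : forall n (A : set (V' n)), measurable A ->
       nu' n A = kact (nu n) (L n) A)
    (hnuL' : forall n (A : set (V n)), measurable A ->
       nu n A = kact (nu' n) (L' n) A) :
  (t0 n / t n @[n --> \oo] --> 0 ->
     (cut_off P nu t <-> cut_off P' nu' t))
  /\
  (forall w : nat -> R, (forall n, 0 < w n) ->
     limn_esup (fun n => (t0 n / w n)%:E) = 0%E ->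
     (window_cut_off P nu t w <-> window_cut_off P' nu' t w) /\
     (forall eta : R -> R, continuous eta ->
        (profile_cut_off P nu t w eta <-> profile_cut_off P' nu' t w eta))).
Proof.
have le_tv n a b := @worst_tv_le_interweaving _ _ _ _ _ _ _ _ _ _ _ _ a b
  (hP n) (hP' n) (hint n) (@hnuL n) (ht0 n).
have le_tv' n a b := @worst_tv_le_interweaving _ _ _ _ _ _ _ _ _ _ _ _ a b
  (hP' n) (hP n) (symmetric_interweaving_sym (hint n)) (@hnuL' n) (ht0 n).
split=> [t0t|w w0 sup_t0w]; first split.
(* The two comparisons are exchanged by symmetry, so each converse is the same transfer lemma with
   [le_tv] and [le_tv'] swapped. *)
- exact (cut_off_transfer le_tv le_tv' ht t0t).
- exact (cut_off_transfer le_tv' le_tv ht t0t).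
have t0w : t0 n / w n @[n --> \oo] --> 0.
  by apply: limn_esup0_cvg => // n; rewrite divr_ge0// ltW.
split=> [|eta ceta]; split.
- exact (window_cut_off_transfer le_tv le_tv' ht w0 t0w).
- exact (window_cut_off_transfer le_tv' le_tv ht w0 t0w).
- exact (profile_cut_off_transfer le_tv le_tv' ht w0 ceta t0w).
- exact (profile_cut_off_transfer le_tv' le_tv ht w0 ceta t0w).
Qed.
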